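(* There exist constants $c>0$ and $n_0$ such that for every integer $n\ge n_0$ there is a set $B$ of $n$ natural numbers such that the product set $B.B=\{bb' : b,b'\in B\}$ contains an arithmetic progression of length at least $c\, n\log n$.
   Context: The length of an arithmetic progression is its number of terms. *)

(* Defs.v *)
From HB Require Import structures.
From mathcomp Require Import all_boot all_order all_algebra finmap.
From mathcomp Require Import reals exp.

Set Implicit Arguments.
Unset Strict Implicit.
Unset Printing Implicit Defensive.

Local Open Scope fset_scope.

Definition product_set (B : {fset nat}) : {fset nat} :=
  [fset (b * b')%N | b in B, b' in B].

(* The common difference is required to be positive, so that the k terms are
   distinct; a progression of naturals with negative difference is the
   reversal of one of these. *)
Definition contains_AP (S : {fset nat}) (k : nat) : Prop :=
  exists a d : nat, (0 < d)%N /\ forall i : nat, (i < k)%N -> (a + i * d)%N \in S.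

(* Main.v *)
Require Import Defs.
From HB Require Import structures.
From mathcomp Require Import all_boot all_order all_algebra finmap.
From mathcomp Require Import reals exp.
From mathcomp Require Import zify lra.

(** The set [B] is Erdős's multiplicative basis of [{1, ..., x ^ 3}]: the
    integers up to [x ^ 2] together with the primes up to [x ^ 3]. If [d] is the
    least divisor of [a <= x ^ 3] with [x <= d], then [a %/ d <= x ^ 2], and
    either [d <= x ^ 2] or [d] is prime. By Chebyshev's upper bound, [B] has
    [O(N / log N)] elements, where [N = x ^ 3]. Taking [x] to be a power of [2]
    and adding further elements to [B] gives the theorem for every [n]. *)

Set Implicit Arguments.
Unset Strict Implicit.
Unset Printing Implicit Defensive.

Import Order.TTheory GRing.Theory Num.Theory.
Local Open Scope ring_scope.

Lemma bin_leq_exp2 (n m : nat) : ('C(n, m) <= 2 ^ n)%N.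
Proof.
elim: n m => [|n IHn] [|m] //; first by rewrite bin0 expn_gt0.
by rewrite binS expnS mul2n -addnn leq_add.
Qed.

Lemma prime_dvd_fact (p n : nat) : prime p -> (p %| n`!)%N = (p <= n)%N.
Proof.
move=> p_pr; apply/idP/idP => [|lepn]; last by rewrite dvdn_fact ?prime_gt0.
elim: n => [|n IHn]; first by rewrite fact0 dvdn1 => /eqP p1; rewrite p1 in p_pr.
rewrite factS Euclid_dvdM // => /orP[/dvdn_leq -> //|/IHn].
by move/leq_trans; apply.
Qed.

(** Such a [p] divides [(n.*2)]!, which is the binomial coefficient times [n]! squared, but not
    [n]!. *)
Lemma prime_dvd_central_bin (p n : nat) :
  prime p -> (n < p <= n.*2)%N -> (p %| 'C(n.*2, n))%N.
Proof.
move=> p_pr /andP[ltnp lepn].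
have := prime_dvd_fact n.*2 p_pr; rewrite lepn.
have le_n : (n <= n.*2)%N by rewrite -addnn leq_addr.
rewrite -(bin_fact le_n) !Euclid_dvdM // !prime_dvd_fact //.
have -> : (n.*2 - n = n)%N by lia.
by rewrite leqNgt ltnp /= !orbF => ->.
Qed.

Lemma prod_primes_dvdn (s : seq nat) (M : nat) :
  uniq s -> all prime s -> all (fun p => p %| M)%N s ->
  (\prod_(p <- s) p %| M)%N.
Proof.
elim: s => [|p s IHs] /=; first by rewrite big_nil dvd1n.
move=> /andP[pNs us] /andP[p_pr s_pr] /andP[pM sM].
rewrite big_cons Gauss_dvd; first by rewrite pM IHs.
rewrite prime_coprime //; apply: contra pNs.
rewrite Euclid_dvd_prod // big_has => /hasP[q qs].
by rewrite dvdn_prime2 ?(allP s_pr q qs) // => /eqP ->.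
Qed.

Lemma expn_size_leq_prod (b : nat) (s : seq nat) :
  all (leq b) s -> (b ^ size s <= \prod_(p <- s) p)%N.
Proof.
elim: s => [|p s IHs] /=; first by rewrite big_nil.
by move=> /andP[bp bs]; rewrite big_cons expnS leq_mul ?IHs.
Qed.

Definition primes_upto (N : nat) : seq nat := [seq p <- iota 1 N | prime p].

(** Each prime in the interval from [2 ^ k] to [2 ^ k.+1] exceeds [2 ^ k], and their product divides
    the central binomial coefficient, which is at most [2 ^ (2 ^ k.+1)]; compare exponents of 2. *)
Lemma size_primes_upto_double (k : nat) :
  (k * (size (primes_upto (2 ^ k.+1)) - size (primes_upto (2 ^ k)))
     <= 2 ^ k.+1)%N.
Proof.
have E : (2 ^ k.+1 = 2 ^ k + 2 ^ k)%N by rewrite expnS mul2n addnn.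
pose s := [seq p <- iota (1 + 2 ^ k) (2 ^ k) | prime p].
have -> : (size (primes_upto (2 ^ k.+1)) - size (primes_upto (2 ^ k)))%N
          = size s.
  by rewrite /primes_upto E iotaD filter_cat size_cat addKn.
rewrite -(@leq_exp2l 2) // expnM.
have s_range p : p \in s -> prime p /\ (2 ^ k < p <= (2 ^ k).*2)%N.
  by rewrite mem_filter mem_iota => /andP[-> p_in]; split=> //; lia.
apply: leq_trans (_ : \prod_(p <- s) p <= _)%N.
  by apply: expn_size_leq_prod; apply/allP => p /s_range[_ /andP[/ltnW]].
apply: leq_trans (_ : 'C((2 ^ k).*2, 2 ^ k) <= _)%N; last first.
  by rewrite E addnn bin_leq_exp2.
apply: dvdn_leq; first by rewrite bin_gt0 -addnn leq_addr.
apply: prod_primes_dvdn; first by rewrite filter_uniq // iota_uniq.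
  by apply/allP => p /s_range[].
by apply/allP => p /s_range[]; exact: prime_dvd_central_bin.
Qed.

Lemma chebyshev_pow2 (k : nat) : (k * size (primes_upto (2 ^ k)) <= 6 * 2 ^ k)%N.
Proof.
elim: k => [//|k IHk].
have [->|[->|k2]] : k = 0%N \/ k = 1%N \/ (2 <= k)%N by lia.
- by [].
- by [].
have := size_primes_upto_double k; move: IHk; rewrite expnS.
set a := size _; set b := size _; set M := (2 ^ k)%N => IHk step.
have kb : (k * b <= 8 * M)%N.
  apply: leq_trans (_ : k * (b - a) + k * a <= _)%N; last by lia.
  by rewrite -mulnDr leq_mul2l; apply/orP; right; lia.
(* This gives [b <= 4 * M], so [k.+1 * b <= 8 * M + 4 * M], which is 6 times [2 ^ k.+1]: the
   constant 6 reproduces itself. *)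
have : (2 * b <= k * b)%N by rewrite leq_mul2r k2 orbT.
lia.
Qed.

Lemma factor_le_square_or_prime (x a : nat) : (0 < x)%N -> (0 < a <= x ^ 3)%N ->
  exists u v : nat,
    [/\ a = (u * v)%N, (u <= x ^ 2)%N & (v <= x ^ 2)%N \/ prime v].
Proof.
move=> x0 /andP[a0 ax].
have xx : (x <= x ^ 2)%N by rewrite expnS expn1 leq_pmulr.
have [xa|ltax] := leqP x a; last first.
  by exists 1%N, a; split; [rewrite mul1n|lia|left; lia].
have [d /andP[da xd] d_min] :
    {d | (d %| a) && (x <= d) & forall e, (e %| a) && (x <= e) -> d <= e}%N.
  have ex_d : exists d, ((d %| a) && (x <= d))%N by exists a; rewrite dvdnn.
  by case: (ex_minnP ex_d) => d; exists d.
have d0 : (0 < d)%N by lia.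
exists (a %/ d)%N, d; split; first by rewrite divnK.
  rewrite -(leq_pmul2r d0) divnK //; apply: leq_trans ax _.
  by rewrite expnSr leq_mul2l xd orbT.
have [|ltd] := leqP d (x ^ 2); [by left|right].
(* With [p] the least prime factor of [d], minimality of [d] forces [d %/ p < x]. Since [x ^ 2 < d],
   this forces [x <= p], and minimality again gives [d = p]. *)
have d1 : (1 < d)%N by lia.
have p_pr := pdiv_prime d1; have pd := pdiv_dvd d.
have dp : (d %/ pdiv d < x)%N.
  rewrite ltnNge; apply/negP => xdp.
  have : (d <= d %/ pdiv d)%N.
    by apply: d_min; rewrite xdp (dvdn_trans (dvdn_div pd)).
  by rewrite leqNgt ltn_Pdiv // prime_gt1.
have xp : (x <= pdiv d)%N.
  rewrite leqNgt; apply/negP => px.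
  have : (d %/ pdiv d * pdiv d <= x * x)%N by rewrite leq_mul // ltnW.
  by rewrite divnK // mulnn leqNgt ltd.
have -> // : d = pdiv d.
apply/eqP; rewrite eqn_leq (dvdn_leq d0 pd) andbT.
by apply: d_min; rewrite xp (dvdn_trans pd).
Qed.

Definition erdos_basis (x : nat) : {fset nat} :=
  [fset b in iota 1 (x ^ 2) ++ primes_upto (x ^ 3)]%fset.

Lemma erdos_basis_gt0 (x b : nat) : b \in erdos_basis x -> (0 < b)%N.
Proof.
by rewrite in_fset /= mem_cat mem_filter !mem_iota; lia.
Qed.

Lemma mem_product_erdos_basis (x a : nat) : (0 < a <= x ^ 3)%N ->
  a \in product_set (erdos_basis x).
Proof.
move=> ax; have x0 : (0 < x)%N by case: x ax => //; lia.
have [u [v [aE ux vx]]] := factor_le_square_or_prime x0 ax.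
have [u0 v0] : (0 < u /\ 0 < v)%N.
  by apply/andP; rewrite -muln_gt0 -aE; case/andP: ax.
(* A prime [v] thus lies below [x ^ 3]. *)
have va : (v <= a)%N by rewrite aE leq_pmull.
rewrite aE; apply: in_imfset2; rewrite in_fset /= mem_cat mem_filter !mem_iota.
  by apply/orP; left; lia.
by case: vx => [vx|->]; apply/orP; [left|right]; lia.
Qed.

(** Chebyshev's bound at exponent [3 * m] contributes [2 * 8 ^ m] for the primes, and [m <= 2 ^ m]
    contributes [8 ^ m] for the initial interval. *)
Lemma card_erdos_basis_pow2 (m : nat) :
  (m * #|` erdos_basis (2 ^ m)|%fset <= 3 * 8 ^ m)%N.
Proof.
have e2 : ((2 ^ m) ^ 2 = 4 ^ m)%N by rewrite -expnM mulnC expnM.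
have e3 : ((2 ^ m) ^ 3 = 8 ^ m)%N by rewrite -expnM mulnC expnM.
apply: leq_trans (_ : m * (4 ^ m + size (primes_upto (8 ^ m))) <= _)%N.
  rewrite leq_mul2l card_fseq (leq_trans (size_undup _)) ?orbT //.
  by rewrite size_cat size_iota e2 e3.
have := chebyshev_pow2 (m * 3); rewrite expnM e3 => prime_count.
have : (m * 4 ^ m <= 8 ^ m)%N.
  by rewrite (expnMn 2 4) leq_mul2r (ltnW (ltn_expl m (isT : 1 < 2)%N)) orbT.
lia.
Qed.

Lemma fset_pos_enlarge (A : {fset nat}) (n : nat) :
  (forall a, a \in A -> 0 < a)%N -> (#|` A|%fset <= n)%N ->
  exists B : {fset nat},
    [/\ (A `<=` B)%fset, #|` B|%fset = n & (forall b, b \in B -> 0 < b)%N].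
Proof.
move=> A0; elim: n => [|n IHn]; first by rewrite leqn0 => /eqP; exists A.
rewrite leq_eqVlt ltnS => /orP[/eqP An|/IHn[B [AB Bn B0]]]; first by exists A.
(* One more than the sum of [B] exceeds every element of [B]. *)
pose w := (\sum_(b <- B) b).+1.
have wB : w \notin B.
  apply/negP => wB; have : (w <= \sum_(b <- B) b)%N.
    by rewrite (big_rem w wB) /= leq_addr.
  by rewrite ltnn.
exists (w |` B)%fset; split.
- exact: fsubset_trans AB (fsubsetU1 _ _).
- by rewrite cardfsU1 wB Bn.
- by move=> b /fset1UP[->|/B0].
Qed.

Lemma product_setS (A B : {fset nat}) :
  (A `<=` B)%fset -> (product_set A `<=` product_set B)%fset.
Proof.
move=> /fsubsetP AB; apply/fsubsetP => _ /imfset2P[a /= aA [b /= bA ->]].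
by apply: in_imfset2; exact: AB.
Qed.

Lemma ln_natr_le_pow8 (R : realType) (n m : nat) :
  (n <= 8 ^ m)%N -> ln (n%:R : R) <= 7 * m%:R.
Proof.
case: n => [|n] nm; first by rewrite ln0 // mulr_ge0.
apply: le_trans (_ : ln ((8 ^ m)%:R : R) <= _).
  by rewrite ler_ln ?posrE ?ltr0n ?expn_gt0 // ler_nat.
rewrite natrX lnXn // -[leLHS]mulr_natr ler_wpM2r //.
(* The crude bound [ln 8 <= 7] comes from [ln (1 + y) <= y]. *)
have -> : 8 = 1 + 7 :> R by lra.
by apply: le_ln1Dx; lra.
Qed.

(** Take the largest [m] meeting the first inequality, which makes the basis for [2 ^ m] fit into
    [n] elements. Failure at [m.+1] gives the second, since [3 * 8 ^ m.+1 = 24 * 8 ^ m]; [24 <= n]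
    makes [m = 1] admissible. *)
Lemma exists_scale (n : nat) : (24 <= n)%N ->
  exists m : nat, [/\ (0 < m)%N, (3 * 8 ^ m <= m * n)%N
                    & (m.+1 * n <= 24 * 8 ^ m)%N].
Proof.
move=> n24.
pose P m := ((0 < m) && (3 * 8 ^ m <= m * n))%N.
have exP : exists m, P m by exists 1%N; rewrite /P mul1n.
have P_le m : P m -> (m <= n)%N.
  move=> /andP[m0 Pm]; have m4 : (m < 4 ^ m)%N by rewrite ltn_expl.
  have m2 : (m < 2 ^ m)%N by rewrite ltn_expl.
  rewrite (expnMn 2 4) in Pm.
  rewrite -(leq_pmul2l m0); apply: leq_trans Pm.
  apply: leq_trans (_ : 2 ^ m * 4 ^ m <= _)%N; last by rewrite leq_pmull.
  by rewrite leq_mul // ltnW.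
have [m /andP[m0 Pm] m_max] := ex_maxnP exP P_le.
exists m; split=> //; rewrite leqNgt; apply/negP => lt_m.
have /m_max : P m.+1 by rewrite /P /= expnS; lia.
by rewrite ltnn.
Qed.

Theorem theorem2 (R : realType) :
  exists (c : R) (n0 : nat), 0 < c /\
    forall n : nat, (n0 <= n)%N ->
      exists B : {fset nat},
        [/\ #|` B|%fset = n,
            (forall b : nat, b \in B -> (0 < b)%N) &
            exists k : nat,
              c * n%:R * ln (n%:R) <= k%:R /\ contains_AP (product_set B) k].
Proof.
(* Here 336 is 24 * 14: 24 from the choice of scale, 14 from [ln n <= 14 * m.+1]. *)
exists (336^-1), 24%N; split; first by rewrite invr_gt0.
move=> n /exists_scale[m [m0 lower upper]].
have card_le : (#|` erdos_basis (2 ^ m)|%fset <= n)%N.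
  by rewrite -(leq_pmul2l m0) (leq_trans (card_erdos_basis_pow2 m)).
have [B [AB Bn B0]] := fset_pos_enlarge (@erdos_basis_gt0 _) card_le.
exists B; split=> //; exists (8 ^ m)%N; split; last first.
  (* The progression is the whole interval from 1 to [8 ^ m]. *)
  exists 1%N, 1%N; split=> // i i_lt; apply: (fsubsetP (product_setS AB)).
  apply: mem_product_erdos_basis.
  have -> : ((2 ^ m) ^ 3 = 8 ^ m)%N by rewrite -expnM mulnC expnM.
  by rewrite muln1 add1n.
have ln_le : ln (n%:R : R) <= 14 * m.+1%:R.
  (* [n <= m.+1 * n <= 24 * 8 ^ m], and 24 is below 64. *)
  have n_le : (n <= 8 ^ m.+2)%N.
    rewrite !expnS; apply: leq_trans (_ : m.+1 * n <= _)%N.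
      by rewrite leq_pmull.
    by lia.
  apply: le_trans (ln_natr_le_pow8 R n_le) _.
  have : (1 <= m%:R :> R) by rewrite ler1n.
  by rewrite -!natr1; lra.
have upperR : m.+1%:R * n%:R <= 24 * (8 ^ m)%:R :> R.
  by rewrite -!natrM ler_nat.
have : n%:R * ln (n%:R : R) <= n%:R * (14 * m.+1%:R) by rewrite ler_wpM2l.
rewrite -mulrA; set t := n%:R * ln _ => t_le.
by rewrite mulrC ler_pdivrMr //; lra.
Qed.
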